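(* Let $m=4$, $r=3$, and for $Z=(c_1,c_2,c_3)\in\mathfrak z=\mathbb R^3$ let $j_Z$, respectively $j'_Z$, be the endomorphism of $\mathfrak v=\mathbb R^4$ given with respect to the standard basis by the matrix $$\begin{pmatrix}0&-2c_1&-2c_2&-2c_3\\2c_1&0&-c_3&c_2\\2c_2&c_3&0&-c_1\\2c_3&-c_2&c_1&0\end{pmatrix},\quad\text{respectively}\quad\begin{pmatrix}0&-c_1&-c_2&-c_3\\c_1&0&-2c_3&2c_2\\c_2&2c_3&0&-2c_1\\c_3&-2c_2&2c_1&0\end{pmatrix}.$$ Then the two isospectral manifolds $(\Gamma(j)\backslash G(j),g(j))$ and $(\Gamma(j')\backslash G(j'),g(j'))$ differ in the value of $\mathrm{Tr}(\mathrm{Ric}^3)$.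
   Context: Let $\mathfrak v=\mathbb R^m$, $\mathfrak z=\mathbb R^r$ carry the standard inner products. Given a linear map $j:\mathfrak z\to\mathfrak{so}(\mathfrak v)$, $Z\mapsto j_Z$, let $\mathfrak g(j)$ be the two-step nilpotent metric Lie algebra with underlying vector space $\mathfrak v\oplus\mathfrak z$, standard inner product, and bracket $[\,,\,]^j$ defined by: $\mathfrak z$ is central, $[\mathfrak v,\mathfrak v]^j\subseteq\mathfrak z$, and $\langle j_ZX,Y\rangle=\langle Z,[X,Y]^j\rangle$ for $X,Y\in\mathfrak v$, $Z\in\mathfrak z$. Let $G(j)$ be the simply connected Lie group with Lie algebra $\mathfrak g(j)$, endowed with the left invariant Riemannian metric $g(j)$ given by this inner product at the identity, and let $\exp^j:\mathfrak g(j)\to G(j)$ be the Lie group exponential map (a diffeomorphism). Put $\Gamma(j):=\exp^j(\mathbb Z^m\oplus\tfrac12\mathbb Z^r)$, which is a discrete cocompact subgroup if $[\mathbb Z^m,\mathbb Z^m]^j\subseteq\mathbb Z^r$ (as is the case here). The quotient $\Gamma(j)\backslash G(j)$ carries the induced metric, again denoted $g(j)$. Two closed Riemannian manifolds are isospectral if their Laplace operators on functions have the same eigenvalues with multiplicities. The two manifolds in the claim are isospectral by a known criterion of Gordon and Wilson. $\mathrm{Ric}$ is the Ricci operator, i.e. the endomorphism of the tangent space corresponding to the Ricci tensor via the metric; by local homogeneity $\mathrm{Tr}(\mathrm{Ric}^3)$ is a constant function on each of the manifolds. *)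

(* Defs.v *)
From HB Require Import structures.
From mathcomp Require Import all_boot all_order all_algebra.
From mathcomp Require Import all_classical all_reals all_analysis.
From mathcomp Require Import ring.

Set Implicit Arguments.
Unset Strict Implicit.
Unset Printing Implicit Defensive.

Import Order.TTheory GRing.Theory Num.Theory numFieldNormedType.Exports.

Local Open Scope classical_set_scope.
Local Open Scope card_scope.
Local Open Scope ring_scope.

Definition dot (R : realType) (n : nat) (u v : 'cV[R]_n) : R :=
  \sum_(i < n) u i 0 * v i 0.

(** Riemannian geometry of R^n with a metric tensor given in the global
    coordinates: [G p] is the Gram matrix of the coordinate frame at [p]. *)

Section Riemannian.
Variables (R : realType) (n : nat).

Definition partial (i : 'I_n) (f : 'cV[R]_n -> R) (p : 'cV[R]_n) : R :=
  'D_(delta_mx i 0) f p.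

(* Every iterated partial derivative is Frechet differentiable everywhere,
   hence continuous: this is C^oo. *)
Definition smooth (f : 'cV[R]_n -> R) : Prop :=
  forall (s : seq 'I_n) (p : 'cV[R]_n), differentiable (foldr partial f s) p.

Variable G : 'cV[R]_n -> 'M[R]_n.

(* The coefficient of d_k in nabla_(d_i) d_j. *)
Definition christoffel (k i j : 'I_n) (p : 'cV[R]_n) : R :=
  2^-1 * \sum_l invmx (G p) k l *
    (partial i (fun x => G x j l) p + partial j (fun x => G x i l) p
     - partial l (fun x => G x i j) p).

(* The coefficient of d_l in R(d_i, d_j) d_k, where
   R(X, Y) = nabla_X nabla_Y - nabla_Y nabla_X - nabla_[X,Y]. *)
Definition curvature (l k i j : 'I_n) (p : 'cV[R]_n) : R :=
  partial i (christoffel l j k) p - partial j (christoffel l i k) p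
  + \sum_h (christoffel l i h p * christoffel h j k p
            - christoffel l j h p * christoffel h i k p).

(* Ric(Y, Z) is the trace of X |-> R(X, Y) Z. *)
Definition ricci_tensor (p : 'cV[R]_n) : 'M[R]_n :=
  \matrix_(j, k) \sum_i curvature i k i j p.

(* The endomorphism A with G(A Y, Z) = Ric(Y, Z), in the coordinate frame. *)
Definition ricci_operator (p : 'cV[R]_n) : 'M[R]_n :=
  invmx (G p) *m ricci_tensor p.

Definition tr_ric3 (p : 'cV[R]_n) : R := \tr (ricci_operator p ^+ 3).

(* Laplace-Beltrami operator with the sign making it nonnegative. *)
Definition laplacian (f : 'cV[R]_n -> R) (p : 'cV[R]_n) : R :=
  - ((Num.sqrt (\det (G p)))^-1 *
     \sum_i partial i (fun x => Num.sqrt (\det (G x)) *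
                         \sum_j invmx (G x) i j * partial j f x) p).

End Riemannian.

(** G(j) is R^(m+r) in exponential coordinates: exp^j is the identity map, and
    the product is the Campbell-Hausdorff product of the two-step nilpotent
    Lie algebra g(j). *)

Section Nilmanifold.
Variables (R : realType) (m r : nat).
Variable j : {linear 'cV[R]_r -> 'M[R]_m}.

Definition bracket (p q : 'cV[R]_(m + r)) : 'cV[R]_(m + r) :=
  col_mx 0 (\col_(k < r) dot (j (delta_mx k 0) *m usubmx p) (usubmx q)).

Definition nil_mul (p q : 'cV[R]_(m + r)) : 'cV[R]_(m + r) :=
  p + q + 2^-1 *: bracket p q.

Lemma bracketP (X Y : 'cV[R]_m) (Z : 'cV[R]_r) :
  dot (j Z *m X) Y = dot Z (dsubmx (bracket (col_mx X 0) (col_mx Y 0))).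
Proof.
have jZ : j Z = \sum_k Z k 0 *: j (delta_mx k 0).
  rewrite [in LHS](matrix_sum_delta Z) linear_sum; apply: eq_bigr => k _.
  by rewrite big_ord1 linearZ.
rewrite /bracket col_mxKd /dot jZ.
under eq_bigr do rewrite mulmx_suml summxE mulr_suml.
rewrite exchange_big; apply: eq_bigr => k _.
rewrite mxE !col_mxKu mulr_sumr; apply: eq_bigr => i _.
by rewrite -scalemxAl mxE mulrA.
Qed.

(* g(j) at [p] is the standard inner product pulled back by the differential
   at [p] of left translation by [p^-1 = - p]. *)
Definition nil_metric (p : 'cV[R]_(m + r)) : 'M[R]_(m + r) :=
  \matrix_(a, b) dot ('D_(delta_mx a 0) (nil_mul (- p)) p)
                     ('D_(delta_mx b 0) (nil_mul (- p)) p).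

Definition nil_lattice : set 'cV[R]_(m + r) :=
  [set col_mx (map_mx intr ab.1) (2^-1 *: map_mx intr ab.2)
     | ab in [set: 'cV[int]_m * 'cV[int]_r]].

(* Functions on the quotient of G(j) by Gamma(j), and the Laplacian on them,
   are read on G(j) through the covering, which is a local isometry. *)
Definition eigenfunction (lambda : R) (f : 'cV[R]_(m + r) -> R) : Prop :=
  [/\ smooth f,
      forall gamma p, nil_lattice gamma -> f (nil_mul gamma p) = f p
    & forall p, laplacian nil_metric f p = lambda * f p].

Definition multiplicity_ge (lambda : R) (N : nat) : Prop :=
  exists F : 'I_N -> 'cV[R]_(m + r) -> R,
    (forall i, eigenfunction lambda (F i)) /\
    (forall c : 'I_N -> R,
       (forall p, \sum_i c i * F i p = 0) -> forall i, c i = 0).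

End Nilmanifold.

(* Real eigenfunctions suffice: the Laplacian is a real operator with real
   spectrum, so real and complex multiplicities agree. *)
Definition isospectral (R : realType) (m r : nat)
    (j j' : {linear 'cV[R]_r -> 'M[R]_m}) : Prop :=
  forall (lambda : R) (N : nat),
    multiplicity_ge j lambda N <-> multiplicity_ge j' lambda N.

Definition skew (R : realType) (m r : nat)
    (j : {linear 'cV[R]_r -> 'M[R]_m}) : Prop :=
  forall Z, (j Z)^T = - j Z.

Definition int_vector (R : realType) (n : nat) : set 'cV[R]_n :=
  range (map_mx intr : 'cV[int]_n -> 'cV[R]_n).

Definition integral_bracket (R : realType) (m r : nat)
    (j : {linear 'cV[R]_r -> 'M[R]_m}) : Prop :=
  forall X Y : 'cV[R]_m, int_vector X -> int_vector Y ->
    int_vector (dsubmx (bracket j (col_mx X 0) (col_mx Y 0))).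

(* The vectors of squared length [rho] in the lattice ker(j_Z) of Z^m. *)
Definition kernel_lattice_sphere (R : realType) (m r : nat)
    (j : {linear 'cV[R]_r -> 'M[R]_m}) (Z : 'cV[R]_r) (rho : R) :
    set 'cV[R]_m :=
  [set X | [/\ int_vector X, j Z *m X = 0 & dot X X = rho]].

(* C. S. Gordon, E. N. Wilson, "Continuous families of isospectral Riemannian
   metrics which are not locally isometric", J. Differential Geom. 47 (1997),
   for the lattices Z^m and Z^r.  Equality of characteristic polynomials says
   that j_Z and j'_Z have the same eigenvalues with multiplicities; equality of
   the spheres for all [rho] says that the kernel lattices have the same length
   spectrum. *)
Definition gordon_wilson_criterion (R : realType) : Prop :=
  forall (m r : nat) (j j' : {linear 'cV[R]_r -> 'M[R]_m}),
    skew j -> skew j' ->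
    integral_bracket j -> integral_bracket j' ->
    (forall Z, char_poly (j Z) = char_poly (j' Z)) ->
    (forall Z rho, int_vector Z ->
       kernel_lattice_sphere j Z rho #= kernel_lattice_sphere j' Z rho) ->
    isospectral j j'.

Section Maps.
Variable R : realType.

Definition mx_of_rows (n : nat) (s : seq (seq R)) : 'M[R]_n :=
  \matrix_(i, k) nth 0 (nth [::] s i) k.

Definition j_map (Z : 'cV[R]_3) : 'M[R]_4 :=
  let c1 := Z 0 0 in let c2 := Z 1 0 in let c3 := Z 2 0 in
  mx_of_rows 4
    [:: [:: 0     ; -2 * c1; -2 * c2; -2 * c3];
        [:: 2 * c1; 0      ; - c3   ; c2     ];
        [:: 2 * c2; c3     ; 0      ; - c1   ];
        [:: 2 * c3; - c2   ; c1     ; 0      ]].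

Definition j'_map (Z : 'cV[R]_3) : 'M[R]_4 :=
  let c1 := Z 0 0 in let c2 := Z 1 0 in let c3 := Z 2 0 in
  mx_of_rows 4
    [:: [:: 0 ; - c1   ; - c2   ; - c3   ];
        [:: c1; 0      ; -2 * c3; 2 * c2 ];
        [:: c2; 2 * c3 ; 0      ; -2 * c1];
        [:: c3; -2 * c2; 2 * c1 ; 0      ]].

Lemma j_map_is_linear : linear j_map.
Proof.
by move=> a X Y; apply/matrixP => i k; rewrite !mxE;
   case: i => [[|[|[|[|i]]]] ?] //; case: k => [[|[|[|[|k]]]] ?] //=;
   ring.
Qed.

Lemma j'_map_is_linear : linear j'_map.
Proof.
by move=> a X Y; apply/matrixP => i k; rewrite !mxE;
   case: i => [[|[|[|[|i]]]] ?] //; case: k => [[|[|[|[|k]]]] ?] //=;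
   ring.
Qed.

HB.instance Definition _ :=
  GRing.isLinear.Build R 'cV[R]_3 'M[R]_4 _ j_map j_map_is_linear.
HB.instance Definition _ :=
  GRing.isLinear.Build R 'cV[R]_3 'M[R]_4 _ j'_map j'_map_is_linear.

Lemma j_map_skew : skew j_map.
Proof.
by move=> Z; apply/matrixP => i k; rewrite !mxE;
   case: i => [[|[|[|[|i]]]] ?] //; case: k => [[|[|[|[|k]]]] ?] //=;
   ring.
Qed.

Lemma j'_map_skew : skew j'_map.
Proof.
by move=> Z; apply/matrixP => i k; rewrite !mxE;
   case: i => [[|[|[|[|i]]]] ?] //; case: k => [[|[|[|[|k]]]] ?] //=;
   ring.
Qed.

End Maps.

(* Main.v *)
Require Import Defs.
From mathcomp Require Import all_boot all_order all_algebra.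
From mathcomp Require Import all_classical all_reals all_analysis.
From mathcomp Require Import ring lra.

Set Implicit Arguments.
Unset Strict Implicit.
Unset Printing Implicit Defensive.

Import Order.TTheory GRing.Theory Num.Theory numFieldNormedType.Exports.

Local Open Scope classical_set_scope.
Local Open Scope ring_scope.

(** Isospectrality is an application of the Gordon-Wilson criterion.  Both [j_Z]
    and [j'_Z] are skew 4 x 4 matrices whose squared entries above the diagonal
    add up to [5 |Z|^2] and whose Pfaffian is [2 |Z|^2] up to sign, so both have the
    characteristic polynomial [X^4 + 5 |Z|^2 X^2 + 4 |Z|^4].  In particular
    their kernels are trivial for [Z <> 0] and everything for [Z = 0], which
    makes the kernel lattices not merely of equal length spectrum but equal.

    For the curvature, write [C k a b] for the structure constants of a two-step
    nilpotent Lie algebra in an orthonormal basis each of whose vectors is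
    either central or orthogonal to the derived algebra.  In exponential
    coordinates the left-invariant coframe is [L = 1 - ad_p / 2], the
    left-invariant frame is its inverse [M = 1 + ad_p / 2] (because
    [ad_p ad_q = 0]), and the metric is [L^T L].  Both [L] and [M] are affine in
    [p], so all derivatives are explicit ([christoffel_metric],
    [partial_christoffel]).  The contraction of the Christoffel symbols vanishes,
    since the volume density is constant, and what remains of the Ricci tensor
    is ([ricci_tensor_metric])
      [L^T (1/4 (tr (C_q^T C_q'))_qq' - 1/2 sum_q C_q^T C_q) L].
    Hence the Ricci operator at any point is [M S L] with [S] the constant matrix
    in the middle, and [tr Ric^3 = tr S^3] ([tr_ric3_metric]).

    For [g(j)] the matrix [S] is block diagonal, with the classical blocks
    [1/2 sum_q j_q^2] on [v] and [- 1/4 tr (j_q j_q')] on [z] ([tr_ric3_nil]).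
    For the two maps at hand both blocks are diagonal: [S] has diagonal
    [-6, -3, -3, -3] and [-3/2, -9/2, -9/2, -9/2] on [v] respectively, and
    [5/2] on [z] in both cases.  The traces of [S] agree, but the cubes
    of the entries on [v] add up to [-297] and to [-1107/4]. *)

(** * Metric, frame and Christoffel symbols of a two-step nilpotent group *)

(** The frame, the coframe and the left translations are affine in the point;
    their difference quotients are constant, and every other function to be
    differentiated is a polynomial in their entries. *)
Lemma is_derive_affine (R : realType) (V W : normedModType R)
    (f : V -> W) (p v : V) (d : W) :
  (forall h : R, f (h *: v + p) = f p + h *: d) -> is_derive p v f d.
Proof.
move=> fE.
have cv : h^-1 *: (f (h *: v + p) - f p) @[h --> (0:R)^'] --> d.
  apply: (@cvg_trans _ ((fun _ : R => d) @ (0:R)^')); last exact: cvg_cst.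
  apply: near_eq_cvg; near=> h.
  have h0 : h != 0 by near: h; exact: nbhs_dnbhs_neq.
  by rewrite fE addrAC subrr add0r scalerA mulVf // scale1r.
split; first by apply/cvg_ex; exists d.
exact: cvg_lim cv.
Unshelve. all: by end_near.
Qed.

Section Structure.
Variables (R : realType) (n : nat) (C : 'I_n -> 'M[R]_n).
Hypothesis skewC : forall k a b, C k a b = - C k b a.
(* The derived algebra is central, in the form available for an adapted basis:
   a basis vector occurring in the value of a bracket brackets to zero with
   everything. *)
Hypothesis nilC : forall k a b c d, C k a b * C a c d = 0.

Definition ad (p : 'cV[R]_n) : 'M[R]_n :=
  \matrix_(k, b) \sum_a p a 0 * C k a b.

Definition coframe (p : 'cV[R]_n) : 'M[R]_n := 1%:M - 2^-1 *: ad p.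
Definition frame (p : 'cV[R]_n) : 'M[R]_n := 1%:M + 2^-1 *: ad p.
Definition metric (p : 'cV[R]_n) : 'M[R]_n := (coframe p)^T *m coframe p.

Local Notation L := coframe.
Local Notation M := frame.
Local Notation E i := (ad (delta_mx i 0)).

Lemma trC k : (C k)^T = - C k.
Proof. by apply/matrixP => a b; rewrite !mxE skewC. Qed.

Lemma C_diag k a : C k a a = 0.
Proof. by have := skewC k a a; lra. Qed.

(** In [C k k a] the index [k] is both an argument and a value of the bracket, so
    this constant squares to zero. *)
Lemma C_upl k a : C k k a = 0.
Proof. by apply/eqP; rewrite -sqrf_eq0 expr2 nilC. Qed.

Lemma nilCr k a b c d : C k b a * C a c d = 0.
Proof. by rewrite skewC mulNr nilC oppr0. Qed.

Lemma adE i k b : E i k b = C k i b.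
Proof.
rewrite mxE (bigD1 i) //= big1 ?addr0 => [|a ai]; rewrite mxE ?eqxx ?mul1r //.
by rewrite (negPf ai) mul0r.
Qed.

Lemma adD p q : ad (p + q) = ad p + ad q.
Proof.
apply/matrixP => k b; rewrite !mxE -big_split; apply: eq_bigr => a _.
by rewrite mxE mulrDl.
Qed.

Lemma adZ h p : ad (h *: p) = h *: ad p.
Proof.
apply/matrixP => k b; rewrite !mxE mulr_sumr; apply: eq_bigr => a _.
by rewrite mxE mulrA.
Qed.

Lemma mul_C_ad k p : C k *m ad p = 0.
Proof.
apply/matrixP => a b; rewrite !mxE big1 // => c _; rewrite mxE mulr_sumr big1 //.
by move=> d _; rewrite mulrCA nilCr mulr0.
Qed.

Lemma mul_ad_ad p q : ad p *m ad q = 0.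
Proof.
apply/matrixP => a b; rewrite !mxE big1 // => c _; rewrite !mxE mulr_suml big1 //.
move=> d _; rewrite mulr_sumr big1 // => e _.
by rewrite mulrACA nilCr mulr0.
Qed.

Lemma mul_frame_coframe p : M p *m L p = 1%:M.
Proof.
rewrite mulmxDl mul1mx mulmxBr mulmx1 -scalemxAl -scalemxAr mul_ad_ad.
by rewrite !scaler0 subr0 subrK.
Qed.

Lemma mul_coframe_frame p : L p *m M p = 1%:M.
Proof. exact: mulmx1C (mul_frame_coframe p). Qed.

Lemma mul_C_frame k p : C k *m M p = C k.
Proof. by rewrite mulmxDr mulmx1 -scalemxAr mul_C_ad scaler0 addr0. Qed.

Lemma mul_C_coframe k p : C k *m L p = C k.
Proof. by rewrite mulmxBr mulmx1 -scalemxAr mul_C_ad scaler0 subr0. Qed.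

Lemma mul_coframe_ad p q : L p *m ad q = ad q.
Proof. by rewrite mulmxBl mul1mx -scalemxAl mul_ad_ad scaler0 subr0. Qed.

Lemma mul_ad_frame p q : ad q *m M p = ad q.
Proof. by rewrite mulmxDr mulmx1 -scalemxAr mul_ad_ad scaler0 addr0. Qed.

Lemma invmx_metric p : invmx (metric p) = M p *m (M p)^T.
Proof.
have inv : metric p *m (M p *m (M p)^T) = 1%:M.
  rewrite /metric -mulmxA (mulmxA (L p)) mul_coframe_frame mul1mx.
  by rewrite -trmx_mul mul_frame_coframe trmx1.
have [Gu _] := mulmx1_unit inv.
by rewrite -[LHS]mulmx1 -inv mulKmx.
Qed.

Lemma is_derive_coframe (i k b : 'I_n) p :
  is_derive p (delta_mx i 0 : 'cV[R]_n) (fun x => L x k b) (- 2^-1 * C k i b).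
Proof.
apply: is_derive_affine => h; rewrite /coframe adD adZ -adE.
by rewrite 9!mxE /GRing.scale /=; rewrite !mxE; ring.
Qed.

Lemma is_derive_frame_mul (i k b : 'I_n) (A : 'M[R]_n) p :
  is_derive p (delta_mx i 0 : 'cV[R]_n) (fun x => (M x *m A) k b)
    (2^-1 * (E i *m A) k b).
Proof.
apply: is_derive_affine => h; rewrite /frame adD adZ !mulmxDl -!scalemxAl mulmxDl.
rewrite -scalemxAl; set P := ad p *m A; set Q := _ *m A.
by rewrite !mxE /GRing.scale /=; ring.
Qed.

Lemma is_derive_sum_prod (U V : 'I_n -> 'cV[R]_n -> R)
    (dU dV : 'I_n -> R) (p v : 'cV[R]_n) :
  (forall k, is_derive p v (U k) (dU k)) ->
  (forall k, is_derive p v (V k) (dV k)) ->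
  is_derive p v (fun x => \sum_k U k x * V k x)
    (\sum_k (dU k * V k p + U k p * dV k)).
Proof.
move=> DU DV.
rewrite (_ : (fun x => _) = \sum_k (U k * V k)); last first.
  by apply/funext => x; rewrite fct_sumE.
apply: is_derive_sum => k; apply: is_derive_eq (is_deriveM (DU k) (DV k)) _.
by rewrite /GRing.scale /= addrC [V k p * _]mulrC.
Qed.

Lemma metricE p a b : metric p a b = \sum_k L p k a * L p k b.
Proof. by rewrite mxE; apply: eq_bigr => k _; rewrite mxE. Qed.

Lemma partial_metric (i a b : 'I_n) p :
  partial i (fun x => metric x a b) p =
  - 2^-1 * \sum_k (C k i a * L p k b + L p k a * C k i b).
Proof.
rewrite (_ : (fun x => _) = fun x => \sum_k L x k a * L x k b); last first.
  by apply/funext => x; rewrite metricE.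
have D := is_derive_sum_prod (fun k => is_derive_coframe i k a p)
  (fun k => is_derive_coframe i k b p).
rewrite /partial (@derive_val _ _ _ _ _ _ _ D) mulr_sumr.
by apply: eq_bigr => k _; ring.
Qed.

(** By skew symmetry the terms with [C k i j] and [C k j i] cancel, and the other
    four are equal in pairs. *)
Lemma first_kind (i j l : 'I_n) p :
  partial i (fun x => metric x j l) p + partial j (fun x => metric x i l) p
    - partial l (fun x => metric x i j) p =
  - \sum_k (C k i l * L p k j + C k j l * L p k i).
Proof.
rewrite !partial_metric -!mulrDr -mulrBr -big_split -sumrB mulr_sumr -sumrN.
apply: eq_bigr => k _ /=.
by rewrite (skewC k j i) (skewC k l i) (skewC k l j); field.
Qed.

(** Raising the index [l] multiplies by [M M^T]; as [C_k M = C_k], one of the two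
    factors is absorbed and the symbols become products of affine functions. *)
Lemma christoffel_metric (s i j : 'I_n) p :
  christoffel metric s i j p =
  2^-1 * \sum_k ((M p *m C k) s i * L p k j + (M p *m C k) s j * L p k i).
Proof.
rewrite /christoffel; congr (_ * _).
under eq_bigr do rewrite first_kind invmx_metric mulrN mulr_sumr.
under eq_bigr do rewrite -sumrN.
rewrite exchange_big; apply: eq_bigr => k _ /=.
have half i' : \sum_l (M p *m (M p)^T) s l * C k i' l = - (M p *m C k) s i'.
  transitivity ((M p *m (M p)^T *m (C k)^T) s i').
    by rewrite [RHS]mxE; apply: eq_bigr => l _; rewrite [(C k)^T _ _]mxE.
  by rewrite -mulmxA -trmx_mul mul_C_frame trC mulmxN mxE.
rewrite -[_ s i]opprK -[_ s j]opprK -!half !mulNr !mulr_suml -opprD -big_split -sumrN.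
by apply: eq_bigr => l _ /=; ring.
Qed.

Lemma partial_christoffel (a s i j : 'I_n) p :
  partial a (christoffel metric s i j) p =
  4^-1 * \sum_k ((E a *m C k) s i * L p k j - (M p *m C k) s i * C k a j
               + ((E a *m C k) s j * L p k i - (M p *m C k) s j * C k a i)).
Proof.
have D b c := is_derive_sum_prod
  (fun k => is_derive_frame_mul a s b (C k) p)
  (fun k => is_derive_coframe a k c p).
have chE : christoffel metric s i j = 2^-1 \*:
    ((fun x => \sum_k (M x *m C k) s i * L x k j)
     + (fun x => \sum_k (M x *m C k) s j * L x k i)).
  by apply/funext => x; rewrite christoffel_metric big_split.
have Dch := is_deriveZ (2^-1) (is_deriveD (D i j) (D j i)).
rewrite /partial chE (@derive_val _ _ _ _ _ _ _ Dch) /GRing.scale /=.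
rewrite -big_split !mulr_sumr.
by apply: eq_bigr => k _ /=; field.
Qed.

Lemma mxtrace_frame_C p q : \tr (M p *m C q) = 0.
Proof. by rewrite mxtrace_mulC mul_C_frame /mxtrace big1 // => i _; rewrite C_diag. Qed.

Lemma ad_C_diag i q a : (E a *m C q) i i = 0.
Proof. by rewrite mxE big1 // => b _; rewrite adE mulrC nilCr. Qed.

(** This contraction is the logarithmic derivative of the volume density, which
    is constant because [L] is unipotent. *)
Lemma christoffel_contract k p : \sum_i christoffel metric i i k p = 0.
Proof.
under eq_bigr do rewrite christoffel_metric.
rewrite -mulr_sumr exchange_big big1 ?mulr0 //= => q _.
rewrite big_split /= -mulr_suml.
have -> : \sum_i (M p *m C q) i i = \tr (M p *m C q) by [].
rewrite mxtrace_frame_C mul0r add0r.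
transitivity ((L p *m (M p *m C q)) q k).
  by rewrite mxE; apply: eq_bigr => i _; rewrite mulrC.
by rewrite mulmxA mul_coframe_frame mul1mx C_upl.
Qed.

(** * The Ricci tensor *)

(** Differentiating [M] along [d_i] and contracting gives the constants
    [C i i b], which vanish; the derivative of [L] pairs [M C_q] with [C_q], where
    [M] is absorbed since [M^T C_q = C_q]. *)
Lemma christoffel_divergence j k p :
  \sum_i partial i (christoffel metric i j k) p =
  - 2^-1 * (\sum_q (C q)^T *m C q) j k.
Proof.
have upper q b : \sum_i (E i *m C q) i b = 0.
  by rewrite big1 // => i _; rewrite mxE big1 // => c _; rewrite adE C_upl mul0r.
have MC q : (M p *m C q)^T *m C q = (C q)^T *m C q.
  rewrite trmx_mul -mulmxA; congr (_ *m _); apply: trmx_inj.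
  by rewrite trmx_mul trmxK trC mulNmx mul_C_frame.
have lower q b c : \sum_i (M p *m C q) i b * C q i c = ((C q)^T *m C q) b c.
  by rewrite -MC [RHS]mxE; apply: eq_bigr => i _; rewrite [_^T _ _]mxE.
under eq_bigr do rewrite partial_christoffel.
rewrite -mulr_sumr exchange_big summxE !mulr_sumr; apply: eq_bigr => q _ /=.
rewrite big_split !sumrB /= -!mulr_suml !upper !lower !mul0r !sub0r.
have -> : ((C q)^T *m C q) k j = ((C q)^T *m C q) j k.
  by rewrite -[in LHS](trmxK (C q)) -trmx_mul mxE trmxK.
by field.
Qed.

(** The first two families of terms are traces that vanish; the last two are
    [L (E_j C_q)] and [E_j (M C_q)], which are equal because [L] and [M] act as
    the identity next to [E_j]. *)
Lemma partial_christoffel_contract j k p :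
  \sum_i partial j (christoffel metric i i k) p = 0.
Proof.
under eq_bigr do rewrite partial_christoffel.
rewrite -mulr_sumr exchange_big big1 ?mulr0 //= => q _.
rewrite big_split !sumrB /= -!mulr_suml.
have -> : \sum_i (M p *m C q) i i = \tr (M p *m C q) by [].
rewrite mxtrace_frame_C.
rewrite [X in X * _]big1 => [|i _]; last exact: ad_C_diag.
have -> : \sum_i (E j *m C q) i k * L p q i = (L p *m (E j *m C q)) q k.
  by rewrite [RHS]mxE; apply: eq_bigr => i _; rewrite mulrC.
have -> : \sum_i (M p *m C q) i k * C q j i = (E j *m (M p *m C q)) q k.
  by rewrite [RHS]mxE; apply: eq_bigr => i _; rewrite mulrC adE.
by rewrite !mulmxA mul_coframe_ad mul_ad_frame; ring.
Qed.

(** Twice the matrix of Christoffel symbols with lower index [j], rewritten in the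
    left-invariant frame: conjugation by [L] turns traces of products of
    Christoffel matrices into traces of these simpler ones. *)
Definition connection_mx (j : 'I_n) (p : 'cV[R]_n) : 'M[R]_n :=
  \sum_q L p q j *: C q - (E j)^T.

Lemma christoffel_mx j p :
  \matrix_(s, h) christoffel metric s j h p =
  2^-1 *: (M p *m connection_mx j p *m L p).
Proof.
rewrite /connection_mx [M p *m _]mulmxBr mulmxBl mulmx_sumr mulmx_suml.
apply/matrixP => s h; rewrite [LHS]mxE christoffel_metric [RHS]mxE; congr (_ * _).
rewrite [RHS]mxE [in RHS]summxE big_split /= addrC; congr (_ + _).
  apply: eq_bigr => q _.
  by rewrite -scalemxAr -scalemxAl -mulmxA mul_C_coframe [RHS]mxE mulrC.
rewrite -mulNmx -mulmxN [RHS]mxE; apply: eq_bigr => q _; congr (_ * _).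
rewrite !mxE; apply: eq_bigr => l _; congr (_ * _).
by rewrite [RHS]mxE [in RHS]mxE adE; exact: skewC.
Qed.

Definition lower_gram : 'M[R]_n := \sum_q (C q)^T *m C q.
Definition upper_gram : 'M[R]_n := \matrix_(q, q') \tr ((C q)^T *m C q').

(** Two-step nilpotency makes every product involving [E] traceless, so only the
    products [C_q C_q'] contribute. *)
Lemma mxtrace_connection_mx j k p :
  \tr (connection_mx j p *m connection_mx k p) = - ((L p)^T *m upper_gram *m L p) j k.
Proof.
have FE (l l' : 'I_n) : (\sum_q L p q l *: C q) *m E l' = 0.
  by rewrite mulmx_suml big1 // => q _; rewrite -scalemxAl mul_C_ad scaler0.
have FT l : (\sum_q L p q l *: C q)^T = - \sum_q L p q l *: C q.
  rewrite linear_sum -sumrN; apply: eq_bigr => q _.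
  by rewrite linearZ /= trC scalerN.
have EF l l' : (E l')^T *m (\sum_q L p q l *: C q) = 0.
  by rewrite -[X in _ *m X]trmxK -trmx_mul FT mulNmx FE oppr0 trmx0.
have tF l l' : \tr ((\sum_q L p q l *: C q) *m (E l')^T) = 0.
  by rewrite mxtrace_mulC EF mxtrace0.
rewrite /connection_mx mulmxBr !mulmxBl EF -trmx_mul mul_ad_ad trmx0 !subr0.
rewrite raddfB /= tF subr0 mulmx_suml raddf_sum [in RHS]mxE -sumrN.
under [RHS]eq_bigr => q' _ do rewrite mxE mulr_suml -sumrN.
rewrite [RHS]exchange_big /=; apply: eq_bigr => q _.
rewrite mulmx_sumr raddf_sum; apply: eq_bigr => q' _ /=.
rewrite -scalemxAl -scalemxAr !mxtraceZ !mxE trC mulNmx raddfN /=; ring.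
Qed.

(** The Ricci tensor at the identity, in the orthonormal basis. *)
Definition lie_ricci : 'M[R]_n := 4^-1 *: upper_gram - 2^-1 *: lower_gram.

Lemma ricci_tensorE (G : 'cV[R]_n -> 'M[R]_n) p j k :
  ricci_tensor G p j k =
  (\sum_i partial i (christoffel G i j k) p
   - \sum_i partial j (christoffel G i i k) p)
  + (\sum_h (\sum_i christoffel G i i h p) * christoffel G h j k p
     - \sum_i \sum_h christoffel G i j h p * christoffel G h i k p).
Proof.
rewrite mxE /curvature big_split sumrB; congr (_ + _) => /=.
rewrite (eq_bigr _ (fun i _ => sumrB _ _ _ _)) sumrB; congr (_ - _).
by rewrite exchange_big; apply: eq_bigr => h _; rewrite -mulr_suml.
Qed.

(** Left invariance of the Ricci tensor: its coefficients in the left-invariant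
    frame are constant.  The divergence term yields the lower Gram matrix, which
    [L] fixes since [C_q L = C_q]; the quadratic term yields the upper one. *)
Lemma ricci_tensor_metric p :
  ricci_tensor metric p = (L p)^T *m lie_ricci *m L p.
Proof.
have low : (L p)^T *m lower_gram *m L p = lower_gram.
  rewrite mulmx_sumr mulmx_suml; apply: eq_bigr => q _.
  by rewrite mulmxA -trmx_mul -mulmxA !mul_C_coframe.
rewrite /lie_ricci [_^T *m _]mulmxBr mulmxBl -!scalemxAr -!scalemxAl low.
apply/matrixP => j k; rewrite ricci_tensorE.
rewrite [X in X - _ + _]christoffel_divergence.
rewrite [X in _ - X + _]partial_christoffel_contract.
rewrite [X in _ + (X - _)]big1 => [|h _]; last first.
  by rewrite christoffel_contract mul0r.
have -> : \sum_i \sum_h christoffel metric i j h p * christoffel metric h i k p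
    = \tr ((\matrix_(s, h) christoffel metric s j h p) *m
           (\matrix_(s, h) christoffel metric s k h p)).
  apply: eq_bigr => i _; rewrite mxE; apply: eq_bigr => h _; rewrite !mxE.
  congr (_ * _); rewrite !christoffel_metric; congr (_ * _).
  by apply: eq_bigr => q _; rewrite addrC.
rewrite !christoffel_mx -scalemxAl -scalemxAr !mxtraceZ -!mulmxA mxtrace_mulC.
rewrite -!mulmxA mul_coframe_frame mulmx1 !mulmxA.
rewrite -[_ *m L p *m M p]mulmxA mul_coframe_frame mulmx1 mxtrace_connection_mx.
rewrite [RHS]mxE [X in _ = X + _]mxE [X in _ = _ + X]mxE [in X in _ = _ + X]mxE.
by field.
Qed.

Lemma tr_ric3_metric p : tr_ric3 metric p = \tr (lie_ricci ^+ 3).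
Proof.
have opE : ricci_operator metric p = M p *m lie_ricci *m L p.
  rewrite /ricci_operator invmx_metric ricci_tensor_metric -!mulmxA.
  by rewrite (mulmxA _^T) -trmx_mul mul_coframe_frame trmx1 mul1mx.
rewrite /tr_ric3 opE !exprS !expr0 !mulr1.
rewrite -!mulmxE -!mulmxA.
have LM (X : 'M[R]_n) : L p *m (M p *m X) = X.
  by rewrite mulmxA mul_coframe_frame mul1mx.
by rewrite !LM mxtrace_mulC -!mulmxA mul_coframe_frame mulmx1.
Qed.

End Structure.

(** * Ricci curvature of g(j) *)

Section NilmanifoldRicci.
Variables (R : realType) (m r : nat) (j : {linear 'cV[R]_r -> 'M[R]_m}).

Local Notation J q := (j (delta_mx q 0)).

Definition nil_const (k : 'I_(m + r)) : 'M[R]_(m + r) :=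
  if fintype.split k is inr q then block_mx (J q)^T 0 0 0 else 0.

Lemma nil_constl k : nil_const (lshift r k) = 0.
Proof. by rewrite /nil_const; case: split_ordP => q // /eqP; rewrite eq_lrshift. Qed.

Lemma nil_constr q : nil_const (rshift m q) = block_mx (J q)^T 0 0 0.
Proof.
rewrite /nil_const; case: split_ordP => q' => [/eqP|]; first by rewrite eq_rlshift.
by move=> /rshift_inj ->.
Qed.

Lemma bracketE p q k : bracket j p q k 0 = (p^T *m nil_const k *m q) 0 0.
Proof.
case: (split_ordP k) => {}k ->.
  by rewrite nil_constl mulmx0 mul0mx col_mxEu !mxE.
rewrite nil_constr col_mxEd mxE.
rewrite -{2}(vsubmxK p) -{2}(vsubmxK q) tr_col_mx mul_row_block.
rewrite !mulmx0 !addr0 mul_row_col mul0mx addr0 -trmx_mul [RHS]mxE.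
by apply: eq_bigr => i _; rewrite [in RHS]mxE.
Qed.

(** Left translation by [- p] is affine with linear part [1 - ad_p / 2], so its
    differential is the coframe and the pulled back inner product is [L^T L]. *)
Lemma nil_metricE p : nil_metric j p = metric nil_const p.
Proof.
suff D b : 'D_(delta_mx b 0) (nil_mul j (- p)) p = col b (coframe nil_const p).
  apply/matrixP => a b; rewrite mxE !D metricE.
  by apply: eq_bigr => k _; rewrite [X in X * _]mxE [X in _ * X]mxE.
suff /(@derive_val _ _ _ _ _ _ _): is_derive p (delta_mx b 0 : 'cV[R]_(m + r))
  (nil_mul j (- p)) (col b (coframe nil_const p)) by [].
apply: is_derive_affine => h; apply/matrixP => k i; rewrite (ord1 i) {i}.
have -> : (h *: delta_mx b 0 : 'cV[R]_(m + r)) + p = p + h *: delta_mx b 0.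
  exact: addrC.
have br : bracket j (- p) (p + h *: delta_mx b 0) k 0 =
    bracket j (- p) p k 0 - h * (ad nil_const p) k b.
  rewrite !bracketE mulmxDr -scalemxAr -colE mxE; congr (_ + _).
  rewrite linearN /= !mulNmx !mxE mulrN; congr (- (_ * _)).
  by apply: eq_bigr => a _; rewrite mxE.
rewrite /nil_mul /coframe; move: br; move: (ad _ _) => A.
move: (bracket j _ _) (bracket j _ _) => X Y br.
by rewrite !mxE br eqxx andbT; ring.
Qed.

Hypothesis skewj : Defs.skew j.

Lemma nil_const_skew k a b : nil_const k a b = - nil_const k b a.
Proof.
have trN : (nil_const k)^T = - nil_const k.
  rewrite /nil_const; case: fintype.split => q; first by rewrite trmx0 oppr0.
  by rewrite tr_block_mx opp_block_mx !trmx0 !oppr0 skewj linearN /= skewj.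
by rewrite -[in LHS](trmxK (nil_const k)) trN mxE mxE.
Qed.

Lemma nil_const_nil k a b c d : nil_const k a b * nil_const a c d = 0.
Proof.
case: (split_ordP a) => {}a ->.
  by rewrite nil_constl mxE mulr0.
rewrite {1}/nil_const; case: fintype.split => q; first by rewrite mxE mul0r.
by case: (split_ordP b) => {}b ->;
  rewrite ?block_mxEdl ?block_mxEdr mxE mul0r.
Qed.

(** The restrictions of the Ricci operator to [v] and to [z]: the two subspaces are
    orthogonal for the Ricci tensor. *)
Definition ricci_v : 'M[R]_m := 2^-1 *: \sum_q J q *m J q.
Definition ricci_z : 'M[R]_r := \matrix_(q, q') (- 4^-1 * \tr (J q *m J q')).

Lemma lie_ricci_nil : lie_ricci nil_const = block_mx ricci_v 0 0 ricci_z.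
Proof.
have CC q q' : (nil_const (rshift m q))^T *m nil_const (rshift m q') =
    block_mx (- (J q *m J q')) 0 0 0.
  rewrite !nil_constr tr_block_mx mulmx_block !trmx0 !mulmx0 !mul0mx !addr0.
  by rewrite trmxK skewj mulmxN.
have low : lower_gram nil_const = block_mx (- \sum_q J q *m J q) 0 0 0.
  rewrite /lower_gram big_split_ord /= big1 ?add0r => [|q _]; last first.
    by rewrite nil_constl mulmx0.
  under eq_bigr do rewrite CC.
  rewrite -sumrN; elim/big_ind2 : _ => [|A X B Y -> ->|q _ //].
    by rewrite block_mx0.
  by rewrite add_block_mx !addr0.
have up : upper_gram nil_const = block_mx 0 0 0 (4 *: ricci_z).
  apply/matrixP => a b; rewrite mxE.
  case: (split_ordP a) => {}a ->; case: (split_ordP b) => {}b ->.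
  - by rewrite nil_constl trmx0 mul0mx mxtrace0 block_mxEul mxE.
  - by rewrite nil_constl trmx0 mul0mx mxtrace0 block_mxEur mxE.
  - by rewrite nil_constl mulmx0 mxtrace0 block_mxEdl mxE.
  - by rewrite CC mxtrace_block mxtrace0 addr0 block_mxEdr raddfN !mxE /=; field.
rewrite /lie_ricci low up !scale_block_mx opp_block_mx add_block_mx.
by rewrite !scaler0 !oppr0 !addr0 add0r scalerN opprK scalerA mulVf ?scale1r ?pnatr_eq0.
Qed.

Lemma tr_ric3_nil p :
  tr_ric3 (nil_metric j) p = \tr (ricci_v ^+ 3) + \tr (ricci_z ^+ 3).
Proof.
rewrite (_ : nil_metric j = metric nil_const); last exact/funext/nil_metricE.
rewrite (tr_ric3_metric nil_const_skew nil_const_nil) lie_ricci_nil.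
rewrite !exprS !expr0 !mulr1 -!mulmxE.
by rewrite !mulmx_block !(mulmx0, mul0mx, addr0, add0r) mxtrace_block.
Qed.

End NilmanifoldRicci.

Lemma tr_ric3_diag (R : realType) (m r : nat) (j : {linear 'cV[R]_r -> 'M[R]_m}) d b p :
  Defs.skew j -> ricci_v j = diag_mx d -> ricci_z j = b%:M ->
  tr_ric3 (nil_metric j) p = \sum_i d 0 i ^+ 3 + b ^+ 3 *+ r.
Proof.
move=> skewj Ev Ez; rewrite tr_ric3_nil // Ev Ez !exprS !expr0 !mulr1 -!mulmxE.
rewrite !mulmx_diag -!scalar_mxM mxtrace_scalar mxtrace_diag; congr (_ + _).
by apply: eq_bigr => i _; rewrite !mxE.
Qed.

Section RicciExample.
Variable R : realType.

Lemma ricci_v_j :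
  ricci_v (@j_map R) = diag_mx (\row_i nth 0 [:: -6; -3; -3; -3] i).
Proof.
apply/matrixP => i k; rewrite !mxE summxE !big_ord_recr big_ord0 /= !mxE.
rewrite !big_ord_recr !big_ord0 /= !mxE /=.
by case: i => [[|[|[|[|i]]]] ?] //; case: k => [[|[|[|[|k]]]] ?] //=; field.
Qed.

Lemma ricci_z_j : ricci_z (@j_map R) = (5 / 2)%:M.
Proof.
apply/matrixP => i k; rewrite mxE /mxtrace !big_ord_recr !big_ord0 /= !mxE.
rewrite !big_ord_recr !big_ord0 /= !mxE /=.
by case: i => [[|[|[|i]]] ?] //; case: k => [[|[|[|k]]] ?] //=; field.
Qed.

Lemma ricci_v_j' :
  ricci_v (@j'_map R) = diag_mx (\row_i nth 0 [:: - (3/2); - (9/2); - (9/2); - (9/2)] i).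
Proof.
apply/matrixP => i k; rewrite !mxE summxE !big_ord_recr big_ord0 /= !mxE.
rewrite !big_ord_recr !big_ord0 /= !mxE /=.
by case: i => [[|[|[|[|i]]]] ?] //; case: k => [[|[|[|[|k]]]] ?] //=; field.
Qed.

Lemma ricci_z_j' : ricci_z (@j'_map R) = (5 / 2)%:M.
Proof.
apply/matrixP => i k; rewrite mxE /mxtrace !big_ord_recr !big_ord0 /= !mxE.
rewrite !big_ord_recr !big_ord0 /= !mxE /=.
by case: i => [[|[|[|i]]] ?] //; case: k => [[|[|[|k]]] ?] //=; field.
Qed.

End RicciExample.

(** * Hypotheses of the Gordon-Wilson criterion *)

Lemma integral_bracket_int_entries (R : realType) (m r : nat)
    (j : {linear 'cV[R]_r -> 'M[R]_m}) :
  (forall q a b, j (delta_mx q 0) a b \is a Num.int) -> integral_bracket j.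
Proof.
move=> jint _ _ [X _ <-] [Y _ <-].
exists (\col_q \sum_a (\sum_b Num.floor (j (delta_mx q 0) a b) * X b 0) * Y a 0) => //.
apply/matrixP => q i; rewrite (ord1 i) /bracket col_mxKd !mxE !col_mxKu.
rewrite rmorph_sum; apply: eq_bigr => a _ /=.
rewrite rmorphM rmorph_sum !mxE; congr (_ * _); apply: eq_bigr => b _ /=.
by rewrite rmorphM /= mxE floorK.
Qed.

Lemma integral_bracket_j (R : realType) : integral_bracket (@j_map R).
Proof.
apply: integral_bracket_int_entries => q a b; rewrite !mxE /=.
by case: a => [[|[|[|[|a]]]] ?] //; case: b => [[|[|[|[|b]]]] ?] //=;
  rewrite ?(rpred0, rpredN, rpredM, rpred_nat).
Qed.

Lemma integral_bracket_j' (R : realType) : integral_bracket (@j'_map R).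
Proof.
apply: integral_bracket_int_entries => q a b; rewrite !mxE /=.
by case: a => [[|[|[|[|a]]]] ?] //; case: b => [[|[|[|[|b]]]] ?] //=;
  rewrite ?(rpred0, rpredN, rpredM, rpred_nat).
Qed.

(** Taking the entries from a function on natural numbers makes every minor a
    matrix of the same form, so the expansion can be iterated. *)
Lemma det_fun_recl (S : comNzRingType) n (f : nat -> nat -> S) :
  \det (\matrix_(i < n.+1, k < n.+1) f i k) =
  \sum_(l < n.+1) f 0 l *
    ((-1) ^+ l * \det (\matrix_(i < n, k < n) f i.+1 (bump l k))).
Proof.
rewrite (expand_det_row _ ord0); apply: eq_bigr => l _.
rewrite mxE /cofactor add0n; congr (_ * (_ * \det _)).
by apply/matrixP => i k; rewrite !mxE.
Qed.

Lemma det_fun3 (S : comNzRingType) (f : nat -> nat -> S) :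
  \det (\matrix_(i < 3, k < 3) f i k) =
  f 0 0 * (f 1 1 * f 2 2 - f 1 2 * f 2 1)
  - f 0 1 * (f 1 0 * f 2 2 - f 1 2 * f 2 0)
  + f 0 2 * (f 1 0 * f 2 1 - f 1 1 * f 2 0).
Proof.
have minor l := det_fun_recl 1 (fun i k => f i.+1 (bump l k)).
rewrite det_fun_recl !big_ord_recl big_ord0 !minor !big_ord_recl !big_ord0.
by rewrite !det_mx11 !mxE /bump /=; ring.
Qed.

(** The matrix [x + A] with [A] skew; the last square in its determinant is that of
    the Pfaffian of [A]. *)
Definition skew4_rows (S : comNzRingType) (x a b c d e f : S) : seq (seq S) :=
  [:: [:: x;   a;   b;   c];
      [:: - a; x;   d;   e];
      [:: - b; - d; x;   f];
      [:: - c; - e; - f; x]].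

Lemma det_skew4 (S : comNzRingType) (x a b c d e f : S) :
  \det (\matrix_(i < 4, k < 4) nth 0 (nth [::] (skew4_rows x a b c d e f) i) k) =
  x ^+ 4 + (a ^+ 2 + b ^+ 2 + c ^+ 2 + d ^+ 2 + e ^+ 2 + f ^+ 2) * x ^+ 2
  + (a * f - b * e + c * d) ^+ 2.
Proof.
pose F i k := nth 0 (nth [::] (skew4_rows x a b c d e f) i) k.
have minor l := det_fun3 (fun i k => F i.+1 (bump l k)).
rewrite (det_fun_recl 3 F) !big_ord_recl big_ord0 !minor /F /bump /=; ring.
Qed.

Section KernelExample.
Variable R : realType.

Local Notation normsq c := (c 0 0 ^+ 2 + c 1 0 ^+ 2 + c 2 0 ^+ 2).

Lemma char_poly_j (Z : 'cV[R]_3) :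
  char_poly (j_map Z) =
  'X^4 + (5 * normsq Z)%:P * 'X^2 + (4 * normsq Z ^+ 2)%:P.
Proof.
set c1 := Z 0 0; set c2 := Z 1 0; set c3 := Z 2 0.
have E : char_poly_mx (j_map Z) = \matrix_(i < 4, k < 4) nth 0 (nth [::]
    (skew4_rows 'X (2 * c1)%:P (2 * c2)%:P (2 * c3)%:P c3%:P (- c2)%:P c1%:P) i) k.
  apply/matrixP => i k; rewrite !mxE.
  by case: i => [[|[|[|[|i]]]] ?] //; case: k => [[|[|[|[|k]]]] ?] //=;
    rewrite -/c1 -/c2 -/c3; ring.
by rewrite /char_poly E det_skew4; ring.
Qed.

Lemma char_poly_j' (Z : 'cV[R]_3) :
  char_poly (j'_map Z) =
  'X^4 + (5 * normsq Z)%:P * 'X^2 + (4 * normsq Z ^+ 2)%:P.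
Proof.
set c1 := Z 0 0; set c2 := Z 1 0; set c3 := Z 2 0.
have E : char_poly_mx (j'_map Z) = \matrix_(i < 4, k < 4) nth 0 (nth [::]
    (skew4_rows 'X c1%:P c2%:P c3%:P (2 * c3)%:P (-2 * c2)%:P (2 * c1)%:P) i) k.
  apply/matrixP => i k; rewrite !mxE.
  by case: i => [[|[|[|[|i]]]] ?] //; case: k => [[|[|[|[|k]]]] ?] //=;
    rewrite -/c1 -/c2 -/c3; ring.
by rewrite /char_poly E det_skew4; ring.
Qed.

(** The constant coefficient [4 |Z|^4] of the characteristic polynomial is the
    determinant. *)
Lemma kernel_trivial (A : 'cV[R]_3 -> 'M[R]_4) (Z : 'cV[R]_3) (X : 'cV[R]_4) :
  char_poly (A Z) = 'X^4 + (5 * normsq Z)%:P * 'X^2 + (4 * normsq Z ^+ 2)%:P ->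
  Z != 0 -> A Z *m X = 0 -> X = 0.
Proof.
move=> cE Z0 AX.
have nZ : normsq Z != 0.
  apply: contra Z0 => /eqP nZ.
  have sq i : 0 <= Z i 0 ^+ 2 by exact: sqr_ge0.
  apply/eqP/matrixP => i k; rewrite (ord1 k) mxE; apply/eqP; rewrite -sqrf_eq0.
  have := sq 0; have := sq 1; have := sq 2.
  case: i => [[|[|[|i]]] lti] //.
  - by rewrite (_ : Ordinal lti = 0); [lra | exact: val_inj].
  - by rewrite (_ : Ordinal lti = 1); [lra | exact: val_inj].
  - by rewrite (_ : Ordinal lti = 2); [lra | exact: val_inj].
have dE : \det (A Z) = 4 * normsq Z ^+ 2.
  have := char_poly_det (A Z).
  by rewrite cE !coefD coefXn coefMXn !coefC /= !add0r -signr_odd expr0 mul1r => <-.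
have Au : A Z \in unitmx.
  by rewrite unitmxE dE unitfE mulf_neq0 ?expf_neq0 ?pnatr_eq0.
by rewrite -[X]mul1mx -(mulVmx Au) -mulmxA AX mulmx0.
Qed.

Lemma kernel_lattice_sphere_jE (Z : 'cV[R]_3) (rho : R) :
  kernel_lattice_sphere (@j_map R) Z rho = kernel_lattice_sphere (@j'_map R) Z rho.
Proof.
apply/seteqP; split=> X [XZ]; have [-> _|Z0] := eqVneq Z 0.
- by move=> Xrho; split=> //; rewrite linear0 mul0mx.
- move=> /(kernel_trivial (char_poly_j Z) Z0) -> rhoE.
  by split=> //; [exists 0; rewrite ?map_mx0 | rewrite mulmx0].
- by move=> Xrho; split=> //; rewrite linear0 mul0mx.
- move=> /(kernel_trivial (char_poly_j' Z) Z0) -> rhoE.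
  by split=> //; [exists 0; rewrite ?map_mx0 | rewrite mulmx0].
Qed.

End KernelExample.

Theorem corollary3 (R : realType) :
  (gordon_wilson_criterion R -> isospectral (@j_map R) (@j'_map R)) /\
  exists t t' : R,
    [/\ forall p, tr_ric3 (nil_metric (@j_map R)) p = t,
        forall p, tr_ric3 (nil_metric (@j'_map R)) p = t'
      & t <> t'].
Proof.
split=> [gw|].
  apply: gw.
  - exact: j_map_skew.
  - exact: j'_map_skew.
  - exact: integral_bracket_j.
  - exact: integral_bracket_j'.
  - by move=> Z; rewrite char_poly_j char_poly_j'.
  - by move=> Z rho _; rewrite kernel_lattice_sphere_jE card_eqxx.
exists (- 216 - 27 *+ 3 + (5 / 2) ^+ 3 *+ 3).
exists (- (27 / 8) - 729 / 8 *+ 3 + (5 / 2) ^+ 3 *+ 3).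
split=> [p|p|/eqP].
- rewrite (tr_ric3_diag p (@j_map_skew R) (ricci_v_j R) (ricci_z_j R)).
  by rewrite !big_ord_recl big_ord0 !mxE /=; field.
- rewrite (tr_ric3_diag p (@j'_map_skew R) (ricci_v_j' R) (ricci_z_j' R)).
  by rewrite !big_ord_recl big_ord0 !mxE /=; field.
- by apply/negP/eqP; lra.
Qed.
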